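(* Let $\ell\ge 1$ be a fixed integer and let $k=\max(2,\ell)$. Then the polynomial $P(x)=(2k-3)x^{2k+2}+(1-2k)x^{2k}+x^4-2x^2+1$ has a unique root $\tau$ in the open interval $(0,1)$. Moreover, every graph with maximum degree $\Delta\ge 2$ and girth at least $2\ell+1$ has an acyclic edge-coloring with at most $\lceil(2+\gamma)(\Delta-1)\rceil$ colors, where $\gamma=(\tau^{2k}-\tau^2+1)/(\tau-\tau^3)$.
   Context: An edge-coloring of a graph is acyclic if it is proper (adjacent edges receive different colors) and every cycle contains at least three colors. The girth of a graph is the length of a shortest cycle ($+\infty$ if the graph is acyclic). Graphs are finite. *)

(* Defs.v *)
From HB Require Import structures.
From mathcomp Require Import all_boot all_order all_algebra.
From mathcomp Require Import reals.
Set Implicit Arguments. Unset Strict Implicit. Unset Printing Implicit Defensive.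
Import Order.TTheory GRing.Theory Num.Theory.
Local Open Scope ring_scope.

Definition Ppoly (R : nzRingType) (k : nat) : {poly R} :=
  ((2 * k)%:R - 3)%:P * 'X^(2 * k + 2) + (1 - (2 * k)%:R)%:P * 'X^(2 * k)
  + 'X^4 - 2%:P * 'X^2 + 1.

Definition gammaOf (R : fieldType) (k : nat) (tau : R) : R :=
  (tau ^+ (2 * k) - tau ^+ 2 + 1) / (tau - tau ^+ 3).

Definition simple_graph (T : finType) (e : rel T) : Prop :=
  symmetric e /\ irreflexive e.

Definition deg (T : finType) (e : rel T) (x : T) : nat := #|[set y | e x y]|.
Definition maxdeg (T : finType) (e : rel T) : nat := \max_(x : T) deg e x.

Definition is_graph_cycle (T : finType) (e : rel T) (s : seq T) : bool :=
  (3 <= size s)%N && ucycleb e s.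

Definition girth_ge (T : finType) (e : rel T) (g : nat) : Prop :=
  forall s : seq T, is_graph_cycle e s -> (g <= size s)%N.

Definition edge_coloring (T : finType) (e : rel T) (K : nat)
  (c : T -> T -> 'I_K) : Prop :=
  forall x y, e x y -> c x y = c y x.

Definition proper_edge_coloring (T : finType) (e : rel T) (K : nat)
  (c : T -> T -> 'I_K) : Prop :=
  edge_coloring e c /\
  forall x y z, e x y -> e x z -> y != z -> c x y != c x z.

Definition cycle_colors (T : finType) (K : nat) (c : T -> T -> 'I_K)
  (s : seq T) : seq 'I_K :=
  undup [seq c x (next s x) | x <- s].

Definition acyclic_edge_coloring (T : finType) (e : rel T) (K : nat)
  (c : T -> T -> 'I_K) : Prop :=
  proper_edge_coloring e c /\
  forall s : seq T, is_graph_cycle e s -> (3 <= size (cycle_colors c s))%N.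

(* Main.v *)
Require Import Defs.
From HB Require Import structures.
From mathcomp Require Import all_boot all_order all_algebra.
From mathcomp Require Import boolp reals.
From mathcomp Require Import zify ring lra.
Import Order.TTheory GRing.Theory Num.Theory.
Local Open Scope ring_scope.

(** Let [D] be the maximum degree and [N S] the number of acyclic colourings of
    an edge set [S]. By induction on [S] we show
    [N (S + a) >= (D - 1) / tau * N S] (a counting argument of Rosenfeld type,
    in place of entropy compression). At most [2 (D - 1)] colours of the new
    edge [a] create a conflict or a bicoloured 4-cycle: a colour forbidden by a
    4-cycle is paid for by a colour occurring at both ends of [a]. Any other
    bicoloured cycle through [a] has even length [n >= 2k + 2]; there are at
    most [(D - 1)^(n - 2)] such cycles, and as two consecutive edges determine
    all the others, each accounts for at most [N (S - (n - 3) edges)]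
    [<= (tau / (D - 1))^(n - 3) * N S] colourings. Summing the geometric series,
    [K >= (2 + gamma) (D - 1)] colours suffice because
    [gamma = 1 / tau + tau^(2k - 1) / (1 - tau^2)]. *)

Set Implicit Arguments.
Unset Strict Implicit.
Unset Printing Implicit Defensive.

(** * Cycles, their edges, and bicoloured cycles *)

Section Cycles.
Local Open Scope nat_scope.
Variables (T : finType) (C : eqType).
Implicit Types (s p : seq T) (S : {set {set T}}) (f g : {set T} -> C).

Definition adj S : rel T := fun x y => [set x; y] \in S.

Definition cedge s x : {set T} := [set x; next s x].

(** This form lets colours propagate along a cycle from two consecutive edges. Quantifying over all
    [x] is harmless: [next s] fixes every vertex outside [s]. *)
Definition bicolored f s :=
  forall x, f (cedge s x) = f (cedge s (next s (next s x))).

Lemma adj_sym S : symmetric (adj S).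
Proof. by move=> x y; rewrite /adj setUC. Qed.

Lemma next_notin s x : x \notin s -> next s x = x.
Proof. by move=> xs; rewrite next_nth (negPf xs). Qed.

Lemma next_next_neq s x : uniq s -> 2 < size s -> x \in s ->
  next s (next s x) != x.
Proof.
move=> Us n3 xs; have [i p E] := rot_to xs.
rewrite -!(next_rot i Us) E.
have Up : uniq (x :: p) by rewrite -E rot_uniq.
have : 2 < size (x :: p) by rewrite -E size_rot.
case: p {E} Up => [|y [|z p]] //=; rewrite !inE !negb_or.
move=> /andP[/and3P[xy xz _] _] _.
by rewrite !eqxx (eq_sym y) (negPf xy) eq_sym.
Qed.

Lemma next_neq s x : uniq s -> 2 < size s -> x \in s -> next s x != x.
Proof.
move=> Us n3 xs; apply: contra (next_next_neq Us n3 xs) => /eqP E.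
by rewrite !E.
Qed.

(** If [{x, next x} = {y, next y}] with [x != y], then [y = next x] and [x = next y], so two steps
    return to [x], which length above two excludes. *)
Lemma cedge_inj s : uniq s -> 2 < size s -> {in s &, injective (cedge s)}.
Proof.
move=> Us n3 x y xs ys E.
have : x \in cedge s y by rewrite -E set21.
have : y \in cedge s x by rewrite E set21.
rewrite !inE => /orP[/eqP //|/eqP yE] /orP[/eqP //|/eqP xE].
by move: (next_next_neq Us n3 xs); rewrite -yE -xE eqxx.
Qed.

Lemma iter_next_size s x : uniq s -> iter (size s) (next s) x = x.
Proof.
move=> Us; have [xs|xs] := boolP (x \in s); last first.
  by elim: (size s) => //= n ->; rewrite next_notin.
have cs := cycle_next Us.
by rewrite -(order_cycle cs Us xs) (iter_order_cycle cs).
Qed.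

Lemma mem_iter_next s x y : uniq s -> x \in s -> y \in s ->
  exists j, y = iter j (next s) x.
Proof.
move=> Us xs ys; have cs := cycle_next Us.
exists (findex (next s) x y); rewrite iter_findex //.
by rewrite (fconnect_cycle cs xs).
Qed.

Lemma bicolored_in f g s : {in s, forall x, f (cedge s x) = g (cedge s x)} ->
  bicolored f s -> bicolored g s.
Proof.
move=> fg bf x; have [xs|xs] := boolP (x \in s); last by rewrite !(next_notin xs).
by rewrite -!fg ?mem_next //.
Qed.

Lemma bicolored_iter f s x m : bicolored f s ->
  f (cedge s (iter m.*2 (next s) x)) = f (cedge s x).
Proof.
move=> bf; elim: m => // m IH.
by rewrite doubleS !iterS -bf.
Qed.

Lemma bicolored_rot f s i : uniq s -> bicolored f s -> bicolored f (rot i s).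
Proof. by move=> Us bf x; rewrite /cedge !next_rot // bf. Qed.

Lemma cedge_rev s x : uniq s -> cedge (rev s) (next s x) = cedge s x.
Proof. by move=> Us; rewrite /cedge next_rev // prev_next // setUC. Qed.

Lemma bicolored_rev f s : uniq s -> bicolored f s -> bicolored f (rev s).
Proof.
move=> Us bf x; rewrite !(next_rev Us).
have E y : cedge (rev s) y = cedge s (prev s y).
  by rewrite -{1}(next_prev Us y) cedge_rev.
by rewrite !E [RHS]bf !next_prev.
Qed.

Lemma cycle_cedge S s x : cycle (adj S) s -> x \in s -> cedge s x \in S.
Proof. exact: next_cycle. Qed.

Lemma rot_graph_cycle (r : rel T) i s :
  is_graph_cycle r (rot i s) = is_graph_cycle r s.
Proof. by rewrite /is_graph_cycle size_rot /ucycleb rot_cycle rot_uniq. Qed.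

Lemma rev_graph_cycle S s :
  is_graph_cycle (adj S) (rev s) = is_graph_cycle (adj S) s.
Proof.
rewrite /is_graph_cycle size_rev /ucycleb rev_uniq rev_cycle.
by congr [&& _, _ & _]; apply: eq_cycle => x y; rewrite adj_sym.
Qed.

Lemma graph_cycleP S s : is_graph_cycle (adj S) s ->
  [/\ 2 < size s, uniq s & cycle (adj S) s].
Proof. by case/andP=> n3 /andP[cs us]. Qed.

Lemma cycle_adj S s : uniq s ->
  {in s, forall x, cedge s x \in S} -> cycle (adj S) s.
Proof.
move=> Us sS; have := cycle_next Us.
apply: (sub_in_cycle (P := [in s])); last exact/allP.
by move=> x y xs _ /= /eqP <-; apply: sS.
Qed.

(* Up to rotation and reversal, a cycle through the new edge [{u, v}] starts with [u; v]. *)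
Lemma cycle_through S f s u v : is_graph_cycle (adj ([set u; v] |: S)) s ->
  bicolored f s ->
  is_graph_cycle (adj S) s \/
  exists p, [/\ size (u :: v :: p) = size s, bicolored f (u :: v :: p) &
     is_graph_cycle (adj ([set u; v] |: S)) (u :: v :: p)].
Proof.
move=> gs bs; have [n3 Us cs] := graph_cycleP gs.
have [/allP aS|/allPn[x xs xS]] := boolP (all (fun x => cedge s x \in S) s).
  by left; rewrite /is_graph_cycle n3 /= /ucycleb Us andbT cycle_adj.
have E : cedge s x = [set u; v].
  by have := cycle_cedge cs xs; rewrite !inE (negPf xS) orbF => /eqP.
right.
have start_at r : is_graph_cycle (adj ([set u; v] |: S)) r -> bicolored f r ->
    size r = size s -> u \in r -> next r u = v ->
  exists p, [/\ size (u :: v :: p) = size s, bicolored f (u :: v :: p) &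
     is_graph_cycle (adj ([set u; v] |: S)) (u :: v :: p)].
  move=> gr br rs ur nv; have [r3 Ur _] := graph_cycleP gr.
  have [i p rE] := rot_to ur.
  have := next_rot i Ur u; have := size_rot i r; rewrite nv rE.
  case: p rE => [|y p] rE sz; first by rewrite -sz in r3.
  rewrite [LHS]/= eqxx => yv; exists p.
  rewrite -yv -rE size_rot; split=> //; first exact: bicolored_rot.
  by rewrite rot_graph_cycle yv.
have nx := next_neq Us n3 xs.
have : x \in [set u; v] by rewrite -E set21.
have : next s x \in [set u; v] by rewrite -E set22.
rewrite !inE => /orP[]/eqP nxE /orP[]/eqP xE.
- by rewrite nxE xE eqxx in nx.
- apply: (start_at (rev s)).
  + by rewrite rev_graph_cycle.
  + exact: bicolored_rev.
  + by rewrite size_rev.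
  + by rewrite mem_rev -nxE mem_next.
  + by rewrite next_rev // -nxE prev_next.
- by apply: (start_at s) => //; rewrite -xE.
- by rewrite nxE xE eqxx in nx.
Qed.

Definition proper_on S f := forall x y z, adj S x y -> adj S x z ->
  y != z -> f [set x; y] != f [set x; z].

Definition acyclic_on S f :=
  proper_on S f /\ forall s, is_graph_cycle (adj S) s -> ~ bicolored f s.

Lemma acyclic_on_sub S S' f g : S' \subset S -> {in S', f =1 g} ->
  acyclic_on S f -> acyclic_on S' g.
Proof.
move=> /subsetP sS fg [pf af]; split=> [x y z xy xz|s].
  by rewrite -!fg //; apply: pf; apply: sS.
move=> gs bg; have [n3 Us cs] := graph_cycleP gs.
apply: (af s).
  rewrite /is_graph_cycle n3 /= /ucycleb Us andbT.
  by apply: sub_cycle cs => x y; apply: sS.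
apply: bicolored_in bg => x xs; rewrite fg //.
exact: cycle_cedge.
Qed.

(** On an odd cycle, [size s + 1] is an even number of steps and leads from [x] to [next s x]; two
    adjacent edges would then share a colour. *)
Lemma bicolored_even S f s : is_graph_cycle (adj S) s -> proper_on S f ->
  bicolored f s -> ~~ odd (size s).
Proof.
move=> gs pf bs; have [n3 Us cs] := graph_cycleP gs.
apply/negP => os.
case: s gs bs n3 Us cs os => // x s' gs bs n3 Us cs os.
set s := x :: s' in gs bs n3 Us cs os.
have xs : x \in s by rewrite mem_head.
have := bicolored_iter x (uphalf (size s)) bs.
have -> : (uphalf (size s)).*2 = (size s).+1 by lia.
rewrite iterS iter_next_size //; apply/eqP; rewrite eq_sym.
rewrite {1}/cedge setUC; apply: pf.
- by rewrite adj_sym; apply: cycle_cedge.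
- by apply: cycle_cedge; rewrite // mem_next.
- by rewrite eq_sym next_next_neq.
Qed.

(** Two edges at distance two with different colours, together with the edge between them, already
    show three colours. This links the colour count on cycles to [bicolored]. *)
Lemma few_colors_bicolored S f s : is_graph_cycle (adj S) s -> proper_on S f ->
  size (undup [seq f (cedge s x) | x <- s]) < 3 -> bicolored f s.
Proof.
move=> gs pf sz x; have [n3 Us cs] := graph_cycleP gs.
have [xs|xs] := boolP (x \in s); last by rewrite !(next_notin xs).
apply/eqP; apply: contraLR sz => ne; rewrite -leqNgt.
set y := next s x; set z := next s y.
have col w : w \in s -> f (cedge s w) != f (cedge s (next s w)).
  move=> ws; rewrite {1}/cedge setUC; apply: pf.
  - by rewrite adj_sym; apply: cycle_cedge.
  - by apply: cycle_cedge; rewrite // mem_next.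
  - by rewrite eq_sym next_next_neq.
apply: (@uniq_leq_size _ [:: f (cedge s x); f (cedge s y); f (cedge s z)]).
  by rewrite /= !inE !negb_or ne col // col // mem_next.
move=> c; rewrite !inE mem_undup => /or3P[]/eqP->; apply: map_f => //;
  by rewrite ?mem_next.
Qed.

End Cycles.

(** * Non-backtracking walks and their number *)

Section Walks.
Local Open Scope nat_scope.
Variables (T : finType) (e : rel T) (d : nat).
Hypotheses (e_sym : symmetric e) (e_deg : forall x, #|[set y | e x y]| <= d.+1).

(* Continuations [p] of length [m] of the walk [u; v] that never backtrack. *)
Fixpoint walks (u v : T) (m : nat) : seq (seq T) :=
  if m is m'.+1 then
    flatten [seq map (cons w) (walks v w m') | w <- enum [set w | e v w & w != u]]
  else [:: [::]].

Lemma size_flatten_le (A : Type) (ss : seq (seq A)) b :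
  all (fun s => size s <= b) ss -> size (flatten ss) <= size ss * b.
Proof. by elim: ss => //= s ss IH /andP[sb /IH]; rewrite size_cat mulSn; lia. Qed.

Lemma size_walks u v m : e u v -> size (walks u v m) <= d ^ m.
Proof.
elim: m u v => [|m IH] u v uv //=.
apply: leq_trans (size_flatten_le (b := d ^ m) _) _.
  apply/allP => s /mapP[w]; rewrite mem_enum inE => /andP[vw _] ->.
  by rewrite size_map IH.
rewrite size_map -cardE expnS leq_mul2r; apply/orP; right.
rewrite -ltnS; apply: leq_trans (e_deg v).
(* [u] is itself one of the at most [d + 1] neighbours of [v], so at most [d] continuations
   remain. *)
rewrite (cardsD1 u [set y | e v y]) inE e_sym uv ltnS.
by apply: subset_leq_card; apply/subsetP => w; rewrite !inE andbC.
Qed.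

Lemma mem_walks u v p : path e v p -> uniq (u :: v :: p) ->
  p \in walks u v (size p).
Proof.
elim: p u v => [|w p IH] u v //= /andP[vw pw] /and3P[u_ v_ U].
apply/flattenP; exists (map (cons w) (walks v w (size p))); last first.
  by apply: map_f; apply: IH => //; rewrite cons_uniq v_.
apply: map_f; rewrite mem_enum inE vw /=.
by apply: contra u_ => /eqP <-; rewrite !inE eqxx orbT.
Qed.

Lemma size_mem_walks u v m p : p \in walks u v m -> size p = m.
Proof.
elim: m u v p => [|m IH] u v p /=; first by rewrite inE => /eqP ->.
by move=> /flattenP[_ /mapP[w _ ->]] /mapP[q /IH qm ->] /=; rewrite qm.
Qed.

End Walks.

Lemma set2_inj (T : finType) (x y z : T) : [set x; y] = [set x; z] -> y = z.
Proof.
move=> E; have : y \in [set x; z] by rewrite -E set22.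
have : z \in [set x; y] by rewrite E set22.
by rewrite !inE => /orP[]/eqP-> // /orP[]/eqP.
Qed.

Lemma card_bigcup_seq (I : Type) (T : finType) (r : seq I) (B : I -> {set T}) :
  (#|\bigcup_(i <- r) B i| <= \sum_(i <- r) #|B i|)%N.
Proof.
elim/big_rec2: _ => [|i n A _ IH]; first by rewrite cards0.
by apply: leq_trans (leq_card_setU _ _) _; rewrite leq_add2l.
Qed.

Lemma mem_bigcup_seq (I : eqType) (T : finType) (r : seq I) (B : I -> {set T}) i x :
  i \in r -> x \in B i -> x \in \bigcup_(j <- r) B j.
Proof. by move=> ir xi; rewrite (big_rem i) //= inE xi. Qed.

(** * Colourings as finite functions, and the count of bad ones *)

Section Counting.
Local Open Scope nat_scope.
Variables (T C : finType) (c0 : C).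
Implicit Types (S A D : {set {set T}}) (f g : {ffun {set T} -> C}) (s p : seq T).

(** Fixing the value [c0] outside [S] makes each colouring of [S] a single function, so that
    cardinals count colourings. *)
Definition supported S f := [forall E, (E \notin S) ==> (f E == c0)].

Definition colorings S : {set {ffun {set T} -> C}} :=
  [set f | supported S f && `[< acyclic_on S f >]].

Lemma supportedP S f : reflect (forall E, E \notin S -> f E = c0) (supported S f).
Proof.
by apply: (iffP forallP) => h E; [move/(implyP (h E))/eqP|apply/implyP=> /h/eqP].
Qed.

Definition erase D f : {ffun {set T} -> C} :=
  [ffun E => if E \in D then c0 else f E].

Definition recolor (a : {set T}) (c : C) g : {ffun {set T} -> C} :=
  [ffun E => if E == a then c else g E].

Lemma colorings_erase S D f a : a \notin S -> supported (a |: S) f ->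
  a \in D -> acyclic_on S f -> erase D f \in colorings (S :\: D).
Proof.
move=> aS /supportedP sf aD af; rewrite inE; apply/andP; split.
  apply/supportedP => E; rewrite inE negb_and negbK ffunE.
  have [//|ED] := boolP (E \in D); rewrite /= => ES.
  apply: sf; rewrite !inE negb_or ES andbT.
  by apply: contraNneq ED => ->.
apply/asboolP; apply: acyclic_on_sub af; first exact: subsetDl.
by move=> E; rewrite inE ffunE => /andP[/negPf->].
Qed.

(** Intermediate stage: the local conflicts at [a] are excluded, and only bicoloured cycles through
    [a] of length other than 4 may remain. *)
Definition pre_colorings S a : {set {ffun {set T} -> C}} :=
  [set f | supported (a |: S) f &&
   `[< [/\ acyclic_on S f, proper_on (a |: S) f &
        forall s, is_graph_cycle (adj (a |: S)) s -> size s = 4 ->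
           ~ bicolored f s] >]].

Definition bad_colorings S a s : {set {ffun {set T} -> C}} :=
  [set f in pre_colorings S a |
    is_graph_cycle (adj (a |: S)) s && `[< bicolored f s >]].

(* A bicoloured cycle is determined by the colours of two consecutive edges. *)
Lemma card_bad_colorings S u v p : [set u; v] \notin S ->
  let s := u :: v :: p in
  is_graph_cycle (adj ([set u; v] |: S)) s ->
  exists A, [/\ A \subset S, #|A| = size s - 3 &
    #|bad_colorings S [set u; v] s| <= #|colorings (S :\: A)|].
Proof.
move=> aS s gs; have [n3 Us cs] := graph_cycleP gs.
have us : u \in s by rewrite mem_head.
have ni := next_next_neq Us n3.
have nx := next_neq Us n3.
have nu : next s u = v by rewrite /= eqxx.
clearbody s.
have cu : cedge s u = [set u; v] by rewrite /cedge nu.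
(* [K] holds the start vertices of the two edges following [{u, v}], whose colours are kept; [D]
   gathers all the other edges of the cycle, [{u, v}] included. *)
set K := [set next s u; next s (next s u)].
pose D := [set cedge s y | y in [set y in s] :\: K].
have uD : [set u; v] \in D.
  rewrite -cu; apply: imset_f; rewrite !inE us andbT negb_or.
  by rewrite eq_sym nx // eq_sym ni.
have cardD : #|D| = size s - 2.
  rewrite card_in_imset; last first.
    move=> x y; rewrite !inE => /andP[_ xs] /andP[_ ys].
    exact: (cedge_inj Us n3 xs ys).
  rewrite cardsD cardsE (card_uniqP Us); congr (_ - _).
  rewrite (setIidPr _).
    by rewrite cards2 eq_sym nx // mem_next.
  by apply/subsetP => y; rewrite !inE => /orP[]/eqP->; rewrite !mem_next.
(* The new edge is not in [S], so it is dropped from the witness; this turns [size s - 2] into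
   [size s - 3]. *)
exists (D :\ [set u; v]); split.
- apply/subsetP => E; rewrite in_setD1 => /andP[Ea /imsetP[y]].
  rewrite !inE => /andP[_ ys] EE; subst E.
  have := cycle_cedge cs ys.
  by rewrite !inE (negPf Ea).
- have := cardsD1 [set u; v] D; rewrite uD cardD add1n => E. 
  by apply: succn_inj; rewrite -E; lia.
have -> : S :\: (D :\ [set u; v]) = S :\: D.
  apply/setP => E; rewrite !inE; have [->|//] := eqVneq E [set u; v].
  by rewrite (negPf aS) !andbF.
have inj : {in bad_colorings S [set u; v] s &, injective (erase D)}.
  move=> f g; rewrite !inE => /and3P[/andP[/supportedP sf _] _ /asboolP bf].
  move=> /and3P[/andP[/supportedP sg _] _ /asboolP bg] fg.
  have off E : E \notin D -> f E = g E.
    by move=> ED; have /ffunP/(_ E) := fg; rewrite !ffunE (negPf ED).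
  have onK y : y \in K -> f (cedge s y) = g (cedge s y).
    move=> yK; apply: off; apply/imsetP => -[z]; rewrite !in_setD => /andP[zK].
    rewrite inE => zs /(cedge_inj Us n3) E.
    move: zK; rewrite -E ?yK //.
    by move: yK; rewrite !inE => /orP[]/eqP->; rewrite !mem_next.
  (* Agreement on two consecutive edges spreads around the whole cycle, two steps at a time. *)
  have onI j : f (cedge s (iter j.+1 (next s) u)) = g (cedge s (iter j.+1 (next s) u))
     /\ f (cedge s (iter j.+2 (next s) u)) = g (cedge s (iter j.+2 (next s) u)).
    elim: j => [|j [IH1 IH2]]; first by split; apply: onK; rewrite !inE /= eqxx ?orbT.
    split=> //; move: IH1; rewrite bf bg.
    by rewrite -!iterS.
  apply/ffunP => E; have [/imsetP[y]|] := boolP (E \in D); last exact: off.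
  rewrite !inE => /andP[_ ys] ->.
  (* [onI] covers only positive iterates; [u] itself is reached after a full turn of [size s]
     steps. *)
  have [[|j] ->] := mem_iter_next Us us ys; last by have [] := onI j.
  have [+ _] := onI (size s).-1.
  by rewrite prednK ?iter_next_size //; lia.
rewrite -(card_in_imset inj); apply: subset_leq_card.
apply/subsetP => _ /imsetP[f + ->].
rewrite !inE => /and3P[/andP[sf /asboolP[af _ _]] _ _].
have := colorings_erase aS sf uD af.
by rewrite inE.
Qed.

End Counting.

(** * Extending a colouring by one edge *)

Section Extension.
Local Open Scope nat_scope.
Variables (T C : finType) (c0 : C) (S : {set {set T}}) (u v : T) (d : nat).
Hypotheses (aS : [set u; v] \notin S).
Hypothesis deg_le : forall x, #|[set y | adj ([set u; v] |: S) x y]| <= d.+1.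
Implicit Types (g : {ffun {set T} -> C}).

Let nbr x := [set y | adj S x y].
Let nbr_colors g x := [set g [set x; y] | y in nbr x].

(** In a proper colouring, a colour seen at both [u] and [v] determines one neighbour of each; these
    two form the only edge that can face [{u, v}] in a 4-cycle with that colour on its other two
    sides. The default [u] is never reached for such a colour. *)
Let common_edge g c : {set T} :=
  [set odflt u [pick x in nbr u | g [set u; x] == c];
       odflt u [pick w in nbr v | g [set v; w] == c]].

(* The colours that would close a bicoloured 4-cycle: at most one for each
   colour present at both ends of [{u, v}]. *)
Let square_colors g :=
  [set g (common_edge g c) | c in nbr_colors g u :&: nbr_colors g v].

Let forbidden g := nbr_colors g u :|: nbr_colors g v :|: square_colors g.

Let card_nbr x : x \in [set u; v] -> #|nbr x| <= d.
Proof.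
have nbr_le (y z : T) : [set y; z] = [set u; v] -> #|nbr y| <= d.
  move=> yz; rewrite -ltnS; apply: leq_trans (deg_le y).
  rewrite (cardsD1 z [set w | adj _ y w]) inE /adj yz setU11 ltnS.
  apply: subset_leq_card; apply/subsetP => w; rewrite !inE /adj => yw.
  rewrite yw orbT andbT; apply: contraNneq aS => wz.
  by rewrite -yz -wz.
by rewrite !inE => /orP[]/eqP->; [apply: (nbr_le u v)|apply: (nbr_le v u); rewrite setUC].
Qed.

(** Inclusion-exclusion: the overlap of the two neighbour palettes is what their union saves, and it
    bounds the number of square colours. *)
Let card_forbidden g : #|forbidden g| <= d.*2.
Proof.
have nc x : x \in [set u; v] -> #|nbr_colors g x| <= d.
  by move=> /card_nbr; apply: leq_trans; apply: leq_imset_card.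
have := nc u (set21 _ _); have := nc v (set22 _ _).
have := cardsUI (nbr_colors g u) (nbr_colors g v).
have : #|square_colors g| <= #|nbr_colors g u :&: nbr_colors g v|.
  exact: leq_imset_card.
have [+ _] := leq_card_setU (nbr_colors g u :|: nbr_colors g v) (square_colors g).
rewrite -/(forbidden g); lia.
Qed.

Let pick_color g x y : proper_on S g -> adj S x y ->
  [pick z in nbr x | g [set x; z] == g [set x; y]] = Some y.
Proof.
move=> pg xy; case: pickP => [z|/(_ y)]; last by rewrite !inE xy eqxx.
rewrite !inE => /andP[xz /eqP E]; congr Some; apply/eqP/negPn/negP => zy.
by have := pg _ _ _ xz xy zy; rewrite E eqxx.
Qed.

Lemma recolor_pre_colorings g c : g \in colorings c0 S -> c \notin forbidden g ->
  recolor [set u; v] c g \in pre_colorings c0 S [set u; v].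
Proof.
rewrite inE => /andP[/supportedP sg /asboolP ag].
rewrite !inE !negb_or => /andP[/andP[cu cv] cs].
set a := [set u; v]; set f := recolor a c g.
have a'S : a \notin S by [].
have fa : f a = c by rewrite ffunE eqxx.
have fS E : E != a -> f E = g E by move=> Ea; rewrite ffunE (negPf Ea).
have inS E : E \in a |: S -> E != a -> E \in S by rewrite !inE => /orP[->|].
have afS : acyclic_on S f.
  apply: acyclic_on_sub ag => // E ES; rewrite fS //.
  by apply: contraNneq a'S => <-.
have cn x y : x \in a -> [set x; y] \in S -> g [set x; y] != c.
  rewrite !inE => xa xy; apply: contraNneq (cu) => E.
  case/orP: xa => /eqP xE; first by rewrite -E xE; apply: imset_f; rewrite inE -xE.
  by move/negP: cv; case; rewrite -E xE; apply: imset_f; rewrite inE -xE.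
apply/andP; split.
  apply/supportedP => E; rewrite !inE negb_or => /andP[Ea ES].
  by rewrite fS // sg.
apply/asboolP; split=> //.
  move=> x y z; rewrite /adj.
  have [xy _|xy /inS/(_ xy) xyS] := eqVneq [set x; y] a.
    move=> xz yz; have xza : [set x; z] != a.
      by apply: contra yz => /eqP E; apply/eqP/(@set2_inj _ x); rewrite xy.
    rewrite xy fa fS // eq_sym cn //; first by rewrite -xy set21.
    exact: inS.
  have [xz _ yz|xz /inS/(_ xz) xzS yz] := eqVneq [set x; z] a.
    by rewrite xz fa fS // cn // -xz set21.
  by rewrite !fS //; case: ag => pg _; apply: pg.
move=> s gs s4 bs.
have [gsS|[p []]] := cycle_through gs bs; first by have [_ /(_ _ gsS)] := afS.
rewrite s4; case: p => [|w [|x [|]]] // _ bp gp.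
have [_ Up cp] := graph_cycleP gp.
move: cp Up; rewrite /= !inE !negb_or andbT.
move=> /and4P[_ vw wx xu] /and4P[/and3P[uv uw ux] /andP[vw' vx] wx' _].
have nE : (next [:: u; v; w; x] u = v) * (next [:: u; v; w; x] v = w) *
          (next [:: u; v; w; x] w = x) * (next [:: u; v; w; x] x = u).
  by rewrite /= !eqxx; do ?[rewrite ifN_eqC // | rewrite ifN_eq //].
have := bp u; have := bp v; rewrite /cedge !nE => bv bu.
have nota y z : (y \notin a) || (z \notin a) -> [set y; z] != a.
  by apply: contraTneq => <-; rewrite set21 set22.
have wa : w \notin a by rewrite !inE negb_or eq_sym uw eq_sym vw'.
have xa : x \notin a by rewrite !inE negb_or eq_sym ux eq_sym vx.
have {}vw : adj S v w by apply: inS vw _; rewrite nota ?wa ?orbT.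
have {}xu : adj S u x by rewrite adj_sym; apply: inS xu _; rewrite nota ?xa.
have gE : g [set v; w] = g [set u; x].
  by move: bv; rewrite setUC [in RHS]setUC !fS // nota ?wa ?xa ?orbT.
have [pg _] := ag.
(* The colour of [{u, x}] occurs at both ends; its common edge is [{x, w}], which faces [{u, v}] and
   so has colour [c]. Hence [c] was forbidden. *)
move/negP: cs; apply; apply/imsetP; exists (g [set u; x]).
  by rewrite inE -{2}gE; apply/andP; split; apply: imset_f; rewrite inE.
rewrite /common_edge pick_color // -gE pick_color //= setUC -[in RHS]fS.
  by rewrite -bu fa.
by rewrite nota ?wa.
Qed.

(** Pairs of a colouring and an allowed colour are counted. Recolouring is injective on them: [c] is
    read off at [{u, v}], where every colouring of [S] has the value [c0]. *)
Lemma card_pre_colorings :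
  #|colorings c0 S| * (#|C| - d.*2) <= #|pre_colorings c0 S [set u; v]|.
Proof.
pose E := [set gc : {ffun {set T} -> C} * C |
  (gc.1 \in colorings c0 S) && (gc.2 \notin forbidden gc.1)].
have cE : #|colorings c0 S| * (#|C| - d.*2) <= #|E|.
  have -> : #|E| = \sum_(g in colorings c0 S) #|~: forbidden g|.
    rewrite -sum1_card; under [RHS]eq_bigr do rewrite -sum1_card.
    rewrite pair_big_dep /=; apply: eq_bigl => -[g c].
    by rewrite !inE.
  rewrite -sum_nat_const; apply: leq_sum => g _.
  by rewrite cardsCs setCK; apply: leq_sub2l; apply: card_forbidden.
apply: leq_trans cE _.
rewrite -(card_in_imset (f := fun gc => recolor [set u; v] gc.2 gc.1)).
  apply: subset_leq_card; apply/subsetP => _ /imsetP[[g c]] + ->.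
  by rewrite inE /= => /andP[gS cg]; apply: recolor_pre_colorings.
move=> [g c] [g' c']; rewrite !inE /= => /andP[/andP[/supportedP sg _] _].
move=> /andP[/andP[/supportedP sg' _] _] /ffunP gg'.
congr pair; last by have := gg' [set u; v]; rewrite !ffunE eqxx.
apply/ffunP => F; have := gg' F; rewrite !ffunE.
by have [->|//] := eqVneq F [set u; v]; rewrite sg ?sg'.
Qed.

End Extension.

Lemma geometric_sum_le (R : realFieldType) (y : R) n :
  0 <= y < 1 -> \sum_(i < n) y ^+ i <= (1 - y)^-1.
Proof.
move=> /andP[y0 y1]; have y1' : 0 < 1 - y by rewrite subr_gt0.
rewrite -[leRHS]mul1r ler_pdivlMr // mulrC -opprB mulNr -subrX1 opprB.
by rewrite lerBlDr lerDl exprn_ge0.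
Qed.

(** * Growth of the number of acyclic colourings *)

Section Growth.
Variables (T C : finType) (c0 : C) (e : rel T) (d k : nat).
Variables (R : realFieldType) (x : R).
Hypotheses (e_sym : symmetric e)
  (e_deg : forall y, (#|[set z | e y z]| <= d.+1)%N)
  (e_cycle : forall s, is_graph_cycle e s -> ~~ odd (size s) -> size s != 4 ->
     (2 * k + 2 <= size s)%N).
Hypotheses (d_gt0 : (0 < d)%N) (k_gt0 : (0 < k)%N) (x01 : 0 < x < 1).
Hypothesis card_C :
  d%:R * (2 + (x^-1 + x ^+ (2 * k).-1 / (1 - x ^+ 2))) <= #|C|%:R.
Implicit Types (S A : {set {set T}}) (p s : seq T).

Definition edges : {set {set T}} :=
  [set E | [exists y, exists z, e y z && (E == [set y; z])]].

Lemma adj_edges y z : adj edges y z = e y z.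
Proof.
rewrite /adj inE; apply/existsP/idP => [[y' /existsP[z']]|yz]; last first.
  by exists y; apply/existsP; exists z; rewrite yz /=.
move=> /andP[yz /eqP E].
have : y \in [set y'; z'] by rewrite -E set21.
rewrite !inE => /orP[]/eqP yE; subst y; first by rewrite (set2_inj E).
by rewrite [RHS]setUC in E; rewrite (set2_inj E) e_sym.
Qed.

Let N S : R := #|colorings c0 S|%:R.
(** The growth factor per edge; in the application [d] is the maximum degree minus one and [x] is
    the root [tau]. *)
Let beta : R := d%:R / x.

Let beta_gt0 : 0 < beta.
Proof. by case/andP: x01 => x0 _; rewrite divr_gt0 ?ltr0n. Qed.

Section Step.
Variables (S : {set {set T}}) (u v : T).
Hypotheses (S_edges : S \subset edges) (uv : e u v) (aS : [set u; v] \notin S).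

Let bad p := bad_colorings c0 S [set u; v] (u :: v :: p).

Let adj_sub : subrel (adj ([set u; v] |: S)) e.
Proof.
move=> y z; rewrite -adj_edges; apply: subsetP.
by rewrite subUset S_edges sub1set -/(adj _ u v) adj_edges uv.
Qed.

(** A defective extension has a bicoloured cycle through [{u, v}]; it is even by [bicolored_even]
    and not of length 4, so [e_cycle] makes it long. *)
Let pre_colorings_cover : pre_colorings c0 S [set u; v] \subset
  colorings c0 ([set u; v] |: S) :|:
  \bigcup_(j < #|T|) \bigcup_(p <- walks e u v (2 * k + 2 * j)) bad p.
Proof.
apply/subsetP => f fX; have := fX; rewrite inE => /andP[sf /asboolP[af pf sq]].
rewrite !inE sf /=; have [//|/=] := boolP `[< _ >].
move=> /asboolPn na.
have [s [gs bs]] : exists s, is_graph_cycle (adj ([set u; v] |: S)) s /\ bicolored f s.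
  apply: contrapT => nex; apply: na; split=> // s gs bs; apply: nex.
  by exists s.
have [gS|[p [_ {s gs}bs gs]]] := cycle_through gs bs; first by have [_ /(_ _ gS)] := af.
have [n3 Up cp] := graph_cycleP gs.
have ev := bicolored_even gs pf bs.
have n4 : size (u :: v :: p) != 4 by apply/eqP => n4; apply: sq bs.
have ge : is_graph_cycle e (u :: v :: p).
  by rewrite /is_graph_cycle n3 /ucycleb Up andbT /=; apply: sub_cycle cp.
have := e_cycle ge ev n4.
have szT : (size (u :: v :: p) <= #|T|)%N by rewrite -(card_uniqP Up) max_card.
move=> szk.
(* [p] omits [u] and [v], so its length is [2k + 2j]; [j] stays below [#|T|] because a cycle repeats
   no vertex. *)
pose j := ((size p)./2 - k)%N.
have szp : size p = (2 * k + 2 * j)%N.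
  move: szk ev; rewrite /j /= negbK => szk ev.
  by have := odd_double_half (size p); rewrite (negPf ev); clear -szk; lia.
have jT : (j < #|T|)%N.
  by apply: leq_trans szT; rewrite /= szp; clearbody j; clear; lia.
apply/bigcupP; exists (Ordinal jT) => //=; rewrite -szp.
apply: (mem_bigcup_seq (i := p)).
  apply: mem_walks => //.
  move: cp => /= /andP[_]; rewrite rcons_path => /andP[+ _].
  exact: sub_path.
by rewrite /bad /bad_colorings in_set fX gs; apply/asboolP.
Qed.

Hypothesis IH : forall A, A \subset S -> beta ^+ #|A| * N (S :\: A) <= N S.

(** The cycle has [m + 3] edges, so the set [A] has [m], and [IH] trades each of them for a factor
    [beta]. A [p] that closes no cycle has no bad colourings. *)
Let card_bad p m : size p = m.+1 -> #|bad p|%:R <= N S / beta ^+ m.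
Proof.
move=> pm; rewrite ler_pdivlMr ?exprn_gt0 //.
have [gs|ngs] := boolP (is_graph_cycle (adj ([set u; v] |: S)) (u :: v :: p)).
  have [A [AS cA bA]] := card_bad_colorings c0 aS gs.
  apply: le_trans (IH AS); rewrite mulrC cA /= pm.
  by rewrite -(ler_nat R) in bA; rewrite subSS subSS subSS subn0 ler_pM2l ?exprn_gt0.
rewrite (_ : bad p = set0) ?cards0 ?mul0r ?ler0n //.
by apply/setP => f; rewrite inE (negPf ngs) andbF inE.
Qed.

Let card_bad_walks j :
  \sum_(p <- walks e u v (2 * k + 2 * j)) #|bad p|%:R
    <= N S * (d%:R * (x ^+ (2 * k).-1 * (x ^+ 2) ^+ j)).
Proof.
case/andP: x01 => x0 _; have d0 : 0 < d%:R :> R by rewrite ltr0n.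
(* There are at most [d ^ m.+1] walks, each costing [N S * (x / d) ^ m]; all but one factor [d]
   cancel. *)
set m := ((2 * k).-1 + 2 * j)%N.
have mE : (2 * k + 2 * j)%N = m.+1 by rewrite /m; clear -k_gt0; lia.
rewrite mE big_seq.
have [ws] : (size (walks e u v m.+1) <= d ^ m.+1)%N by apply: size_walks.
apply: (@le_trans _ _ (\sum_(p <- walks e u v m.+1 | p \in walks e u v m.+1) N S / beta ^+ m)).
  by apply: ler_sum => p /size_mem_walks /card_bad.
rewrite -big_seq big_const_seq count_predT iter_addr_0 -[leLHS]mulr_natr -mulrA.
rewrite ler_wpM2l ?ler0n // -exprM -exprD -/m /beta expr_div_n invf_div mulrC.
rewrite mulrA ler_pdivrMr ?exprn_gt0 // mulrAC -exprS ler_wpM2r ?(exprn_ge0 _ (ltW x0)) //.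
by rewrite -natrX ler_nat.
Qed.

Lemma colorings_step : beta * N S <= N ([set u; v] |: S).
Proof.
case/andP: x01 => x0 x1.
have x2 : 0 <= x ^+ 2 < 1 by rewrite exprn_ge0 ?ltW //= expr_lt1 ?ltW.
have d0 : 0 < d%:R :> R by rewrite ltr0n.
have S0 : 0 <= N S by rewrite ler0n.
have deg_le y : (#|[set z | adj ([set u; v] |: S) y z]| <= d.+1)%N.
  apply: leq_trans (e_deg y); apply: subset_leq_card.
  by apply/subsetP => z; rewrite !inE; apply: adj_sub.
have := leq_trans (card_pre_colorings c0 aS deg_le) (subset_leq_card pre_colorings_cover).
move=> /leq_trans/(_ (leq_card_setU _ _)); rewrite -(ler_nat R) natrD natrM -/(N _).
(* [card_C] forces [#|C| >= 2d], so the truncated subtraction is a true one. *)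
have -> : (#|C| - d.*2)%:R = #|C|%:R - d%:R * 2 :> R.
  rewrite natrB; first by rewrite -muln2 natrM.
  rewrite -(ler_nat R) -muln2 natrM; apply: le_trans card_C.
  rewrite ler_pM2l // lerDl addr_ge0 ?invr_ge0 ?divr_ge0 ?exprn_ge0 ?ltW //.
  by rewrite subr_gt0; case/andP: x2.
set B := #|\bigcup_(_ < _) _|.
have BE : B%:R <= N S * (d%:R * (x ^+ (2 * k).-1 / (1 - x ^+ 2))).
  apply: (@le_trans _ _ (\sum_(j < #|T|) \sum_(p <- walks e u v (2 * k + 2 * j)) #|bad p|%:R)).
    have := card_bigcup_seq (index_enum 'I_#|T|)
      (fun j : 'I_#|T| => \bigcup_(p <- walks e u v (2 * k + 2 * j)) bad p).
    rewrite -/B -(ler_nat R) natr_sum => /le_trans; apply; apply: ler_sum => j _.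
    by rewrite -natr_sum ler_nat card_bigcup_seq.
  apply: (@le_trans _ _ (\sum_(j < #|T|)
      N S * (d%:R * (x ^+ (2 * k).-1 * (x ^+ 2) ^+ j)))).
    by apply: ler_sum.
  rewrite -mulr_sumr ler_wpM2l // -mulr_sumr ler_pM2l // -mulr_sumr.
  by rewrite (ler_wpM2l (exprn_ge0 _ (ltW x0))) // geometric_sum_le.
move=> h; have {h} : N S * (#|C|%:R - d%:R * 2) <= N ([set u; v] |: S)
   + N S * (d%:R * (x ^+ (2 * k).-1 / (1 - x ^+ 2))).
  by apply: le_trans h _; rewrite lerD2l.
(* Once the [2d] forbidden colours and the geometric tail are paid for, [card_C] leaves at least
   [d / x = beta] per colouring of [S]. *)
have := ler_wpM2l S0 card_C.
rewrite /beta; set q := _ / (1 - _); lra.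
Qed.

End Step.

(** Strong induction on [#|S|]: for an edge [a] of [A], the hypothesis at [S :\ a] serves twice, to
    run [colorings_step] and to remove [A :\ a]. *)
Lemma colorings_growth S A : S \subset edges -> A \subset S ->
  beta ^+ #|A| * N (S :\: A) <= N S.
Proof.
elim/ltn_ind: {S}#|S| {-2}S (erefl #|S|) A => n IHn S Sn A SE AS.
have [->|[a aA]] := set_0Vmem A; first by rewrite cards0 expr0 mul1r setD0.
have aS : a \in S := subsetP AS _ aA.
have [u [v [uv aE]]] : exists u v, e u v /\ a = [set u; v].
  have := subsetP SE _ aS; rewrite inE => /existsP[u /existsP[v /andP[uv /eqP aE]]].
  by exists u, v.
have S'n : (#|S :\ a| < n)%N by rewrite -Sn [leqRHS](cardsD1 a) aS.
have S'E : S :\ a \subset edges by apply: subset_trans SE; rewrite subD1set.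
have IH := IHn _ S'n _ (erefl _) _ S'E.
have := colorings_step S'E uv; rewrite -aE setD1K // in_setD1 eqxx => /(_ isT IH).
apply: le_trans; rewrite (cardsD1 a A) aA exprS -mulrA ler_pM2l //.
have := IH (A :\ a) (setSD _ AS).
rewrite (_ : (S :\ a) :\: (A :\ a) = S :\: A) //.
apply/setP => F; rewrite !inE; have [->|//] := eqVneq F a.
by rewrite aA andbF.
Qed.

(** With all edges removed, the growth bound compares [N edges] with the count for the empty edge
    set, which is positive thanks to the constant colouring. *)
Lemma exists_acyclic_coloring : exists f : {ffun {set T} -> C}, acyclic_on edges f.
Proof.
have gr := colorings_growth (subxx edges) (subxx edges).
have : 0 < N edges.
  apply: lt_le_trans gr; rewrite setDv mulr_gt0 ?exprn_gt0 // ltr0n card_gt0.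
  apply/set0Pn; exists [ffun=> c0]; rewrite inE; apply/andP; split.
    by apply/supportedP => E _; rewrite ffunE.
  apply/asboolP; split=> [y z w|s /graph_cycleP[]]; first by rewrite /adj inE.
  by case: s => // y s _ _ cs; have := cycle_cedge cs (mem_head _ _); rewrite inE.
rewrite ltr0n card_gt0 => /set0Pn[f]; rewrite inE => /andP[_ /asboolP af].
by exists f.
Qed.

End Growth.

(** * The root of the polynomial and the form of gamma *)

Section Root.
Variables (R : realType) (k : nat).
Hypothesis k_ge2 : (2 <= k)%N.

Let P := Ppoly R k.

(** Written in [y = x^2], the polynomial shows powers of [1 - y], ready for division by
    [(1 - y)^2]. *)
Lemma horner_Ppoly (x : R) : P.[x] = (1 - x ^+ 2) ^+ 2
  - (x ^+ 2) ^+ k * (((2 * k)%:R - 3) * (1 - x ^+ 2) + 2).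
Proof.
rewrite /P /Ppoly -[X in _ + X]polyC1 !(hornerD, hornerN, hornerM, hornerXn, hornerX, hornerC).
by rewrite -exprM exprD; ring.
Qed.

(* For a root, [1 = y^k ((2k-3)/(1-y) + 2/(1-y)^2)] with [y = x^2], and the
   right-hand side is increasing in [y]. *)
Lemma Ppoly_root_unique (x x' : R) : 0 < x < 1 -> 0 < x' < 1 ->
  root P x -> root P x' -> x = x'.
Proof.
wlog xx' : x x' / x < x' => [WL hx hx' rx rx'|].
  by have [/WL->|/WL->|] := ltgtP x x'.
move=> /andP[x0 x1] /andP[x'0 x'1] rx rx'; exfalso.
have eqn z : 0 < z -> z < 1 -> root P z ->
    (z ^+ 2) ^+ k * (((2 * k)%:R - 3) * (1 - z ^+ 2)^-1 + 2 * (1 - z ^+ 2)^-2) = 1.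
  move=> z0 z1 /rootP; rewrite horner_Ppoly => /eqP; rewrite subr_eq0 => /eqP E.
  have z2 : 1 - z ^+ 2 != 0 by rewrite subr_eq0 eq_sym lt_eqF // expr_lt1 ?ltW.
  have z22 : (1 - z ^+ 2) ^+ 2 != 0 by rewrite expf_neq0.
  by apply: (mulfI z22); rewrite mulr1 [RHS]E; field.
have y0 : 0 < x ^+ 2 by rewrite exprn_gt0.
have yy' : x ^+ 2 < x' ^+ 2 by rewrite ltr_pXn2r ?nnegrE ?ltW.
have y'1 : x' ^+ 2 < 1 by rewrite expr_lt1 ?ltW.
(* From [k >= 2]: a nonnegative coefficient keeps the first summand nondecreasing. *)
have a0 : 0 <= (2 * k)%:R - 3 :> R by rewrite subr_ge0 ler_nat; clear -k_ge2; lia.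
have w0 : 0 < (1 - x ^+ 2)^-1 by rewrite invr_gt0; lra.
have ww' : (1 - x ^+ 2)^-1 < (1 - x' ^+ 2)^-1 by rewrite ltf_pV2 ?posrE; lra.
have /eqP := etrans (eqn _ x0 x1 rx) (esym (eqn _ x'0 x'1 rx')); apply/negP.
rewrite lt_eqF // -!exprVn; apply: ltr_pM.
- by rewrite exprn_ge0 ?ltW.
- by rewrite addr_ge0 ?mulr_ge0 ?exprn_ge0 ?(ltW w0).
- by rewrite ltr_pXn2r ?nnegrE ?(ltW y0) ?(ltW (lt_trans y0 yy')) ?(ltnW k_ge2).
apply: ler_ltD; first exact: (ler_wpM2l a0 (ltW ww')).
by rewrite ltr_pM2l // ltr_pXn2r ?nnegrE ?(ltW w0) ?(ltW (lt_trans w0 ww')).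
Qed.

Lemma Ppoly_has_root : exists2 x : R, 0 < x < 1 & root P x.
Proof.
have P0 : P.[0] = 1.
  by rewrite horner_Ppoly (expr0n _ 2) mulr0n expr0n gtn_eqF ?(ltnW k_ge2) // mulr0n; ring.
have P1 : P.[1] = - 2 by rewrite horner_Ppoly !expr1n; ring.
(* [P] falls from 1 to -2, so the intermediate value theorem is applied to [- P]; the nonzero end
   values then place the root in the open interval. *)
have [||x /andP[x0 x1] rx] := @poly_ivt R (- P) 0 1; first exact: ler01.
  by rewrite !hornerN P0 P1; lra.
rewrite rootN in rx; exists x => //; apply/andP; split.
  rewrite lt_neqAle x0 andbT; apply: contraTneq rx => <-.
  by rewrite rootE P0 oner_eq0.
rewrite lt_neqAle x1 andbT; apply: contraTneq rx => ->.
by rewrite rootE P1 oppr_eq0 pnatr_eq0.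
Qed.

(** Separates the two costs of the count: [1 / x] for the growth factor, and the geometric series
    over long bicoloured cycles. *)
Lemma gammaOfE (x : R) : 0 < x < 1 ->
  gammaOf k x = x^-1 + x ^+ (2 * k).-1 / (1 - x ^+ 2).
Proof.
move=> /andP[x0 x1]; rewrite /gammaOf.
have -> : (2 * k)%N = (2 * k).-1.+1 by lia.
rewrite exprS /=; have xn : x != 0 by rewrite gt_eqF.
have x2 : 1 - x ^+ 2 != 0 by rewrite subr_eq0 eq_sym lt_eqF // expr_lt1 ?ltW.
have -> : x - x ^+ 3 = x * (1 - x ^+ 2) by ring.
by field; rewrite xn x2.
Qed.

End Root.

(** * Choice of the number of colours and return to the graph *)

Unset Implicit Arguments.

Theorem theorem8 (R : realType) (l : nat) (hl : (1 <= l)%N) :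
  let k := maxn 2 l in
  exists tau : R,
    [/\ 0 < tau < 1, root (Ppoly R k) tau,
        (forall sigma : R, 0 < sigma < 1 -> root (Ppoly R k) sigma -> sigma = tau)
      & forall (T : finType) (e : rel T),
          simple_graph e ->
          (2 <= maxdeg e)%N ->
          girth_ge e (2 * l + 1) ->
          exists (K : nat) (c : T -> T -> 'I_K),
            (K%:Z <= Num.ceil ((2 + gammaOf k tau) * ((maxdeg e)%:R - 1)))%R /\
            acyclic_edge_coloring e c].
Proof.
move=> k; have k2 : (2 <= k)%N by rewrite leq_maxl.
have [tau t01 rt] := Ppoly_has_root R k2.
exists tau; split=> // [sigma s01 rs|T e [e_sym _] deg2 girth].
  exact: (Ppoly_root_unique k2).
set d := (maxdeg e).-1.
have dE : (maxdeg e)%:R - 1 = d%:R :> R.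
  by rewrite /d -[in LHS](prednK (ltnW deg2)) -natr1 addrK.
have d_gt0 : (0 < d)%N by rewrite /d; lia.
rewrite dE gammaOfE // mulrC; set z := _ * _.
(* Positivity makes the ceiling at least 1, so a colour [ord0] exists to serve as [c0]. *)
have z0 : 0 < z.
  case/andP: t01 => t0 t1; rewrite mulr_gt0 ?ltr0n //.
  rewrite addr_gt0 // addr_gt0 ?invr_gt0 // divr_gt0 ?exprn_gt0 //.
  by rewrite subr_gt0 expr_lt1 ?ltW.
have cz : z <= (Num.ceil z)%:~R := ceil_ge z.
case: (Num.ceil z) cz => [[|n]|n] cz.
- by move: (lt_le_trans z0 cz); rewrite ltxx.
- exists n.+1.
  have [f [pf af]] : exists f : {ffun {set T} -> 'I_n.+1}, acyclic_on (edges e) f.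
    apply: (@exists_acyclic_coloring T _ ord0 e d k R tau) => //.
    + move=> y; rewrite /d prednK ?(ltnW deg2) //.
      exact: (leq_bigmax_cond (F := deg e)).
    (* If [l >= 2], then [k = l] and an even length at least [2l + 1] is at least [2l + 2]. If
       [l = 1], then [k = 2] and an even length above 2 and other than 4 is at least 6. *)
    + move=> s gs ev n4; have := girth _ gs; rewrite /k.
      by case/andP: gs ev n4 => /[swap] _; lia.
    + exact: ltnW.
    + by rewrite card_ord.
  exists (fun x y => f [set x; y]); split; first by [].
  split=> [|s gs].
    split=> [x y _|x y w xy xw yw]; first by rewrite setUC.
    by apply: pf yw; rewrite adj_edges.
  rewrite leqNgt; apply/negP => few.
  have gs' : is_graph_cycle (adj (edges e)) s.
    move: gs; rewrite /is_graph_cycle /ucycleb.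
    by rewrite (eq_cycle (adj_edges e_sym)).
  exact: af gs' (few_colors_bicolored gs' pf few).
- by have := lt_le_trans z0 cz; rewrite ltr0z.
Qed.
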